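(* Let $A$ be a simple unital stably finite C*-algebra. Suppose that $\mathrm{rc}(\mathrm{Cu}(A),[1_A])=0$. Then $\mathrm{rc}\big(\mathrm{Cu}(A),\mathrm{Full}(\mathrm{Cu}(A))\big)=\{0\}$, i.e. the range of the function $\mathrm{Full}(\mathrm{Cu}(A))\to[0,\infty]$, $x\mapsto\mathrm{rc}(\mathrm{Cu}(A),x)$, is $\{0\}$.
   Context: $\mathcal{K}$ denotes the compact operators on a separable (infinite-dimensional) Hilbert space. For $a,b\in(A\otimes\mathcal{K})_+$, $a\precsim b$ (Cuntz subequivalence) means there is a sequence $(w_n)$ in $A\otimes\mathcal{K}$ with $w_nbw_n^*\to a$; $a\sim b$ means $a\precsim b$ and $b\precsim a$. The Cuntz semigroup is $\mathrm{Cu}(A)=(A\otimes\mathcal{K})_+/\sim$, with $[a]+[b]=[a\oplus b]$ and $[a]\leq[b]$ iff $a\precsim b$. Every increasing sequence in $\mathrm{Cu}(A)$ has a supremum. For $S=\mathrm{Cu}(A)$: an element $x\in S$ is full if $\infty\cdot x=\sup_n n\cdot x$ is the largest element of $S$; $\mathrm{Full}(S)$ is the set of full elements. A functional on $S$ is a map $\lambda\colon S\to[0,\infty]$ that is additive, order preserving, satisfies $\lambda(0)=0$ and preserves suprema of increasing sequences; $\mathcal{F}(S)$ is the set of functionals. The rank of $x$ is $\widehat{x}\colon\mathcal{F}(S)\to[0,\infty]$, $\widehat{x}(\lambda)=\lambda(x)$. For $w\in\mathrm{Full}(S)$ and $r\in(0,\infty)$, $S$ has $r$-comparison relative to $w$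 if whenever $x,y\in S$ satisfy $\widehat{x}+r\cdot\widehat{w}\leq\widehat{y}$ pointwise on $\mathcal{F}(S)$, then $x\leq y$. $\mathrm{rc}(S,w)$ is the infimum of all $r\in(0,\infty)$ such that $S$ has $r$-comparison relative to $w$ ($\infty$ if there is no such $r$). *)

(* Defs.v *)
From HB Require Import structures.
From mathcomp Require Import all_boot all_order all_algebra.
From mathcomp Require Import all_classical all_reals all_analysis.
From mathcomp Require Import complex ring.

Set Implicit Arguments.
Unset Strict Implicit.
Unset Printing Implicit Defensive.

Import Order.TTheory GRing.Theory Num.Theory.
Import numFieldNormedType.Exports.

Local Open Scope classical_set_scope.
Local Open Scope ring_scope.

Reserved Notation "x ** y" (at level 40, left associativity).
Reserved Notation "x ^†" (at level 1, format "x ^†").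

(** * C*-algebras, not necessarily unital *)

HB.mixin Record isCStarAlgebra (R : realType) (A : Type)
    of CompleteNormedModule R[i] A := {
  cmul : A -> A -> A;
  cstar : A -> A;
  cmulA : associative cmul;
  cmulDl : left_distributive cmul +%R;
  cmulDr : right_distributive cmul +%R;
  cmulZl : forall (k : R[i]) x y, cmul (k *: x) y = k *: cmul x y;
  cmulZr : forall (k : R[i]) x y, cmul x (k *: y) = k *: cmul x y;
  cstarK : involutive cstar;
  cstarD : {morph cstar : x y / x + y};
  cstarZ : forall (k : R[i]) x, cstar (k *: x) = Num.conj k *: cstar x;
  cstarM : forall x y, cstar (cmul x y) = cmul (cstar y) (cstar x);
  ler_normcM : forall x y, `|cmul x y| <= `|x| * `|y|;
  cstar_identity : forall x, `|cmul (cstar x) x| = `|x| ^+ 2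
}.

#[short(type="cstarAlgType")]
HB.structure Definition CStarAlgebra (R : realType) :=
  {A of isCStarAlgebra R A & CompleteNormedModule R[i] A}.

Notation "x ** y" := (cmul x y) : ring_scope.
Notation "x ^†" := (cstar x) : ring_scope.

Section CStarNotions.
Context {R : realType} {A : cstarAlgType R}.

Definition is_unit_of (e : A) : Prop := forall a : A, e ** a = a /\ a ** e = a.

Definition closed_ideal (I : set A) : Prop :=
  [/\ closed I, I 0,
      forall a b, I a -> I b -> I (a + b),
      forall (k : R[i]) a, I a -> I (k *: a) &
      forall a b, I a -> I (a ** b) /\ I (b ** a)].

Definition simple_cstar : Prop :=
  (exists a : A, a != 0) /\
  forall I : set A, closed_ideal I -> I = [set 0] \/ I = setT.

(* The *-algebra M_n(A); the library's [*m] is not available because [A] is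
   not one of its rings. *)
Definition cmx_mul n (v w : 'M[A]_n) : 'M[A]_n :=
  \matrix_(i, j) \sum_(k < n) v i k ** w k j.
Definition cmx_star n (v : 'M[A]_n) : 'M[A]_n := \matrix_(i, j) (v j i)^†.
Definition cmx_one n (e : A) : 'M[A]_n := \matrix_(i, j) (if i == j then e else 0).

(* [e] is the unit of [A]: every M_n(A) is finite, i.e. its isometries are
   unitary. *)
Definition stably_finite (e : A) : Prop :=
  forall n (v : 'M[A]_n),
    cmx_mul (cmx_star v) v = cmx_one n e ->
    cmx_mul v (cmx_star v) = cmx_one n e.

(* Standard C*-algebraic positivity: a = x† x. *)
Definition positive (a : A) : Prop := exists x : A, a = x^† ** x.

(* Adjointable pairs [(s, t)], i.e. [t] is the adjoint of [s] as operators on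
   the right Hilbert module A_A; these are the multipliers of [A], with [s x]
   the product of the multiplier and [x], and [t = s†]. *)
Definition adjointable (s t : A -> A) : Prop :=
  forall x y, (s x)^† ** y = x^† ** t y.

(* [s a s†] for a multiplier [s], since [a s† = (s a†)†]. *)
Definition mult_conj (s : A -> A) (a : A) : A := s (s a^†)^†.

End CStarNotions.

Arguments simple_cstar {R} A.

(** * Hilbert spaces and compact operators *)

HB.mixin Record isHilbert (R : realType) (H : Type)
    of CompleteNormedModule R[i] H := {
  hdot : H -> H -> R[i];
  hdotDl : forall x y z, hdot (x + y) z = hdot x z + hdot y z;
  hdotZl : forall (k : R[i]) x z, hdot (k *: x) z = k * hdot x z;
  hdotC : forall x y, hdot y x = Num.conj (hdot x y);
  hdotxx : forall x, hdot x x = `|x| ^+ 2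
}.

#[short(type="hilbertType")]
HB.structure Definition Hilbert (R : realType) :=
  {H of isHilbert R H & CompleteNormedModule R[i] H}.

Section CompactOperators.
Context {R : realType} {H : hilbertType R}.

Definition separable_space : Prop :=
  exists u : nat -> H, dense (range u).

Definition infinite_dim : Prop :=
  forall n, exists f : 'I_n -> H,
    forall c : 'I_n -> R[i], \sum_(i < n) c i *: f i = 0 -> forall i, c i = 0.

Definition compact_op (T : H -> H) : Prop :=
  (forall (k : R[i]) x y, T (k *: x + y) = k *: T x + T y) /\
  precompact (T @` [set x | `|x| <= 1]).

Definition adjoint_op (T T' : H -> H) : Prop :=
  forall x y, hdot (T x) y = hdot x (T' y).

Definition lin_indep_ops n (T : 'I_n -> H -> H) : Prop :=
  forall c : 'I_n -> R[i],
    (forall x, \sum_(i < n) c i *: T i x = 0) -> forall i, c i = 0.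

(* The orthogonal projection onto the line spanned by the unit vector [xi]. *)
Definition rank_one_proj (xi : H) : H -> H := fun x => hdot x xi *: xi.

End CompactOperators.

Arguments separable_space {R} H.
Arguments infinite_dim {R} H.

(** * The stabilization A (x) K *)

(* A C*-algebra [st_alg] which is the completion of the algebraic tensor
   product of [A] with the compact operators K(H) on a separable
   infinite-dimensional Hilbert space [H], for a C*-norm. As K(H) is nuclear
   there is only one such norm, so this determines A (x) K up to isomorphism.
   [st_tens a T] is the elementary tensor, constrained only when [T] is
   compact. [st_tens_norm] says that the norm of an elementary tensor is at
   most the product of the norms, as for every C*-norm on a tensor product.

   The data also contain a choice of two isometries s1, s2 in the multiplier
   algebra M(A (x) K) with s1 s1† + s2 s2† = 1, which identify
   M_2(A (x) K) with A (x) K. *)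
Record stabilization (R : realType) (A : cstarAlgType R) := Stabilization {
  st_hilb : hilbertType R;
  st_separable : separable_space st_hilb;
  st_infinite_dim : infinite_dim st_hilb;
  st_alg : cstarAlgType R;
  st_tens : A -> (st_hilb -> st_hilb) -> st_alg;
  st_tensDl : forall a b T, compact_op T ->
    st_tens (a + b) T = st_tens a T + st_tens b T;
  st_tensDr : forall a S T, compact_op S -> compact_op T ->
    st_tens a (fun x => S x + T x) = st_tens a S + st_tens a T;
  st_tensZl : forall (k : R[i]) a T, compact_op T ->
    st_tens (k *: a) T = k *: st_tens a T;
  st_tensZr : forall (k : R[i]) a T, compact_op T ->
    st_tens a (fun x => k *: T x) = k *: st_tens a T;
  st_tensM : forall a b S T, compact_op S -> compact_op T ->
    st_tens a S ** st_tens b T = st_tens (a ** b) (S \o T);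
  st_tens_star : forall a T T', compact_op T -> compact_op T' ->
    adjoint_op T T' -> (st_tens a T)^† = st_tens a^† T';
  st_tens_inj : forall n (a : 'I_n -> A) (T : 'I_n -> st_hilb -> st_hilb),
    (forall i, compact_op (T i)) -> lin_indep_ops T ->
    \sum_(i < n) st_tens (a i) (T i) = 0 -> forall i, a i = 0;
  st_tens_norm : forall a T (c : R[i]), compact_op T ->
    (forall x, `|T x| <= c * `|x|) -> `|st_tens a T| <= `|a| * c;
  st_tens_dense : dense [set b : st_alg |
    exists n (a : 'I_n -> A) (T : 'I_n -> st_hilb -> st_hilb),
      (forall i, compact_op (T i)) /\ b = \sum_(i < n) st_tens (a i) (T i)];
  st_s1 : st_alg -> st_alg;
  st_s1adj : st_alg -> st_alg;
  st_s2 : st_alg -> st_alg;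
  st_s2adj : st_alg -> st_alg;
  st_s1P : adjointable st_s1 st_s1adj;
  st_s2P : adjointable st_s2 st_s2adj;
  st_s1_isom : forall x, st_s1adj (st_s1 x) = x;
  st_s2_isom : forall x, st_s2adj (st_s2 x) = x;
  st_s_sum : forall x, st_s1 (st_s1adj x) + st_s2 (st_s2adj x) = x
}.

Arguments st_tens {R A} s a T.
Arguments st_s1 {R A} s x.
Arguments st_s2 {R A} s x.
Arguments st_s1adj {R A} s x.
Arguments st_s2adj {R A} s x.
Arguments st_s1P {R A} s.
Arguments st_s2P {R A} s.
Arguments st_s1_isom {R A} s x.
Arguments st_s2_isom {R A} s x.
Arguments st_s_sum {R A} s x.

Section Positivity.
Context {R : realType}.

Section CStarLemmas.
Context {B : cstarAlgType R}.
Implicit Types x y z : B.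

Lemma cmul0r x : 0 ** x = 0.
Proof. by apply: (addrI (0 ** x)); rewrite -cmulDl !addr0. Qed.

Lemma cmulr0 x : x ** 0 = 0.
Proof. by apply: (addrI (x ** 0)); rewrite -cmulDr !addr0. Qed.

Lemma cmulNr x y : x ** (- y) = - (x ** y).
Proof. by apply: (addrI (x ** y)); rewrite -cmulDr !subrr cmulr0. Qed.

Lemma cstar_eq0 x : x^† ** x = 0 -> x = 0.
Proof.
move=> h; have /eqP := cstar_identity x.
by rewrite h normr0 eq_sym expf_eq0/= normr_eq0 => /eqP.
Qed.

Lemma cmulI_nondeg x y : (forall z, z^† ** x = z^† ** y) -> x = y.
Proof.
move=> h; apply/eqP; rewrite -subr_eq0; apply/eqP; apply: cstar_eq0.
by rewrite cmulDr cmulNr h subrr.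
Qed.

Lemma adjointable_sym (s t : B -> B) : adjointable s t -> adjointable t s.
Proof.
by move=> st x y; rewrite -[LHS]cstarK cstarM cstarK -st cstarM cstarK.
Qed.

Lemma adjointableD (s t : B -> B) x y : adjointable s t -> t (x + y) = t x + t y.
Proof. by move=> st; apply: cmulI_nondeg => z; rewrite cmulDr -!st -cmulDr. Qed.

Lemma adjointableM (s t : B -> B) x y : adjointable s t -> t (x ** y) = t x ** y.
Proof. by move=> st; apply: cmulI_nondeg => z; rewrite -st !cmulA -st. Qed.

Lemma mult_conjXX (s t : B -> B) x : adjointable s t -> (forall y, t (s y) = y) ->
  mult_conj s (x^† ** x) = (mult_conj s x)^† ** mult_conj s x.
Proof.
move=> st ts; have sM := adjointableM _ _ (adjointable_sym st).
by rewrite /mult_conj st ts cstarK cstarM cstarK sM cstarM sM.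
Qed.

End CStarLemmas.

Section StabLemmas.
Context {A : cstarAlgType R} (AK : stabilization A).

(* [a ⊕ b = s1 a s1† + s2 b s2†] *)
Definition dsum (a b : st_alg AK) : st_alg AK :=
  mult_conj (st_s1 AK) a + mult_conj (st_s2 AK) b.

Lemma st_s12 x : st_s1adj AK (st_s2 AK x) = 0.
Proof.
have /(congr1 (st_s1adj AK)) := st_s_sum AK (st_s2 AK x).
rewrite (adjointableD _ _ (st_s1P AK)) st_s1_isom st_s2_isom.
by move=> /(canRL (addrK _)); rewrite subrr.
Qed.

Lemma st_s21 x : st_s2adj AK (st_s1 AK x) = 0.
Proof.
have /(congr1 (st_s2adj AK)) := st_s_sum AK (st_s1 AK x).
rewrite (adjointableD _ _ (st_s2P AK)) st_s1_isom st_s2_isom.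
by move=> /(canRL (addKr _)); rewrite addNr.
Qed.

Lemma dsum_positive (a b : st_alg AK) :
  positive a -> positive b -> positive (dsum a b).
Proof.
move=> [x ->] [y ->]; exists (dsum x y).
rewrite /dsum (mult_conjXX x (st_s1P AK) (st_s1_isom AK)).
rewrite (mult_conjXX y (st_s2P AK) (st_s2_isom AK)).
rewrite cstarD cmulDl !cmulDr -addrA; congr (_ + _).
rewrite {3 5}/mult_conj {2 3}/mult_conj.
by rewrite st_s1P st_s12 st_s2P st_s21 !cmulr0 !add0r.
Qed.

Lemma positive0 : positive (0 : st_alg AK).
Proof. by exists 0; rewrite cmulr0. Qed.

End StabLemmas.
End Positivity.

Section RankOne.
Context {R : realType} {H : hilbertType R}.
Implicit Types (x y xi : H).

Lemma hdotDr x y z : hdot x (y + z) = hdot x y + hdot x z.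
Proof. by rewrite hdotC hdotDl rmorphD/= -!hdotC. Qed.

Lemma hdotZr (k : R[i]) x y : hdot x (k *: y) = Num.conj k * hdot x y.
Proof. by rewrite hdotC hdotZl rmorphM/= -hdotC. Qed.

Lemma hdot_unit_le xi x : `|xi| = 1 -> `|hdot x xi| <= `|x|.
Proof.
move=> xi1; set c := hdot x xi.
have : 0 <= hdot (x - c *: xi) (x - c *: xi) by rewrite hdotxx exprn_ge0.
rewrite -scaleNr hdotDl !hdotDr !hdotZl !hdotZr !hdotxx xi1 expr1n mulr1.
rewrite [hdot xi x]hdotC -/c [_ + _](_ : _ = `|x| ^+ 2 - c * Num.conj c).
  by rewrite -normCK subr_ge0 ler_pXn2r// nnegrE.
by rewrite rmorphN/=; ring.
Qed.

Lemma continuous_real_complex : continuous (fun a : R => (a%:C)%C : R[i]^o).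
Proof.
move=> a; apply/cvgrPdist_lt => e e0.
have [eR0 ->] : 0 < complex.Re e /\ e = ((complex.Re e)%:C)%C.
  by case: e e0 => er ei; rewrite ltcE/= => /andP[/eqP -> ->].
near=> b; rewrite -raddfB/= normc_def/= expr0n/= addr0 sqrtr_sqr ltcR.
by near: b; exact: cvgr_dist_lt.
Unshelve. all: by end_near. Qed.

Lemma precompact_line xi :
  precompact [set c *: xi | c in [set c : R[i] | `|c| <= 1]].
Proof.
pose f (p : R * R) := ((p.1%:C)%C + 'i%C * (p.2%:C)%C) *: xi.
have fc : continuous f.
  move=> p; apply: (@cvgZr_tmp _ _ _ _ _ (fun q : R * R => (q.1%:C)%C + 'i%C * (q.2%:C)%C : R[i]^o)).
  apply: (@cvgD _ R[i]^o).
    by apply: (cvg_comp _ _ cvg_fst); exact: continuous_real_complex.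
  apply: (@cvgMl_tmp R[i]); apply: (cvg_comp _ _ cvg_snd).
  exact: continuous_real_complex.
pose I := `[(-1 : R), 1]%classic.
have cI : compact (I `*` I) by apply: compact_setX; exact: segment_compact.
have cfI : compact (f @` (I `*` I)).
  by apply: continuous_compact => //; exact: continuous_subspaceT.
apply: precompact_subset (compact_precompact (@norm_hausdorff _ _) cfI).
move=> _ [[a b] /= c1 <-]; exists (a, b).
  move: c1; rewrite normc_def/= -[1]/((1 : R)%:C)%C lecR => c1.
  have ab : a ^+ 2 + b ^+ 2 <= 1.
    by rewrite -(sqr_sqrtr (addr_ge0 (sqr_ge0 a) (sqr_ge0 b))) expr_le1 ?sqrtr_ge0.
  split; rewrite /I /= in_itv/= -ler_norml -(@expr_le1 _ 2)// real_normK ?num_real//.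
    by apply: le_trans ab; rewrite lerDl sqr_ge0.
  by apply: le_trans ab; rewrite lerDr sqr_ge0.
by rewrite /f/=; congr (_ *: _); simpc.
Qed.

Lemma rank_one_proj_compact xi : `|xi| = 1 -> compact_op (rank_one_proj xi).
Proof.
move=> xi1; split.
  by move=> k x y; rewrite /rank_one_proj hdotDl hdotZl scalerDl scalerA.
apply: precompact_subset (precompact_line xi) => _ [x /= x1 <-].
by exists (hdot x xi) => //=; exact: le_trans (hdot_unit_le x xi1) x1.
Qed.

Lemma rank_one_proj_adj xi : adjoint_op (rank_one_proj xi) (rank_one_proj xi).
Proof.
move=> x y; rewrite /rank_one_proj hdotZl hdotZr mulrC.
by rewrite -hdotC.
Qed.

Lemma rank_one_proj_idem xi : `|xi| = 1 ->
  rank_one_proj xi \o rank_one_proj xi = rank_one_proj xi.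
Proof.
move=> xi1; apply/funext => x; rewrite /rank_one_proj/= hdotZl hdotxx xi1.
by rewrite expr1n mulr1.
Qed.

End RankOne.

(** * Ordered monoids, functionals and the radius of comparison *)

Record ordMonoid := OrdMonoid {
  om_car :> Type;
  om_zero : om_car;
  om_add : om_car -> om_car -> om_car;
  om_le : om_car -> om_car -> Prop
}.

Section RadiusOfComparison.
Context {R : realType} {S : ordMonoid}.
Implicit Types (x y w s : S) (u : nat -> S).

Definition om_muln (n : nat) (x : S) : S := iter n (om_add x) (om_zero S).

Definition om_increasing (u : nat -> S) : Prop :=
  forall n, om_le (u n) (u n.+1).

Definition om_is_sup (u : nat -> S) (s : S) : Prop :=
  (forall n, om_le (u n) s) /\
  (forall t, (forall n, om_le (u n) t) -> om_le s t).

(* The supremum of the multiples of [x] is the largest element. *)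
Definition Full : set S :=
  [set x | exists2 s, om_is_sup (fun n => om_muln n x) s & forall y, om_le y s].

Definition functional (l : S -> \bar R) : Prop :=
  [/\ (forall x, (0 <= l x)%E),
      l (om_zero S) = 0%E,
      (forall x y, l (om_add x y) = (l x + l y)%E),
      (forall x y, om_le x y -> (l x <= l y)%E) &
      (forall u s, om_increasing u -> om_is_sup u s ->
         l s = ereal_sup (range (l \o u)))].

Definition om_rank (x : S) (l : S -> \bar R) : \bar R := l x.

Definition r_comparison (w : S) (r : R) : Prop :=
  forall x y,
    (forall l, functional l ->
       (om_rank x l + r%:E * om_rank w l <= om_rank y l)%E) ->
    om_le x y.

Definition rc (w : S) : \bar R :=
  ereal_inf [set r%:E | r in [set r : R | 0 < r /\ r_comparison w r]].

End RadiusOfComparison.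

Arguments Full : clear implicits.
Arguments rc R {S} w.

(** * The Cuntz semigroup *)

Section CuntzSemigroup.
Context {R : realType}.

Definition cuntz_le (B : cstarAlgType R) (a b : B) : Prop :=
  exists w : nat -> B, (fun n => w n ** b ** (w n)^†) @ \oo --> a.

Definition cuntz_equiv (B : cstarAlgType R) (a b : B) : Prop :=
  cuntz_le a b /\ cuntz_le b a.

Context {A : cstarAlgType R} (AK : stabilization A).

Definition pos_elt := {a : st_alg AK | positive a}.

Definition cuntz_class_set (a : pos_elt) : set pos_elt :=
  [set b | cuntz_equiv (sval b) (sval a)].

(* The quotient of (A (x) K)_+ by Cuntz equivalence, as a set of classes. *)
Definition cu_car := {X : set pos_elt | exists a, X = cuntz_class_set a}.

Definition cu_class (a : pos_elt) : cu_car :=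
  exist _ (cuntz_class_set a) (ex_intro _ a erefl).

Definition cu_repr (X : cu_car) : pos_elt := projT1 (cid (svalP X)).

Definition pos_dsum (a b : pos_elt) : pos_elt :=
  exist _ (dsum (sval a) (sval b)) (dsum_positive (svalP a) (svalP b)).

Definition cu_zero : cu_car := cu_class (exist _ 0 (positive0 AK)).

(* [a] + [b] = [a ⊕ b], computed on chosen representatives; the class of a ⊕ b
   depends neither on these nor on the choice of the isometries s1, s2. *)
Definition cu_add (X Y : cu_car) : cu_car :=
  cu_class (pos_dsum (cu_repr X) (cu_repr Y)).

(* [a] <= [b] iff a is Cuntz subequivalent to b. *)
Definition cu_le (X Y : cu_car) : Prop :=
  exists a b, [/\ X = cu_class a, Y = cu_class b & cuntz_le (sval a) (sval b)].

Definition Cu : ordMonoid := OrdMonoid cu_zero cu_add cu_le.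

Section UnitClass.
Variables (e : A) (xi : st_hilb AK).
Hypotheses (eA : is_unit_of e) (xi1 : `|xi| = 1).

Lemma unit_tens_positive : positive (st_tens AK e (rank_one_proj xi)).
Proof.
have es : e^† = e.
  by have := (eA e^†).1; have := congr1 cstar (eA e^†).1; rewrite cstarM cstarK;
     move=> h1 h2; rewrite -h2 h1.
have pc := rank_one_proj_compact xi1.
exists (st_tens AK e (rank_one_proj xi)).
rewrite (st_tens_star _ pc pc (rank_one_proj_adj xi)) es.
by rewrite st_tensM// (eA e).1 rank_one_proj_idem.
Qed.

(* [1_A], where A sits in A (x) K as a |-> a (x) p for a rank one projection p *)
Definition cu_unit : Cu := cu_class (exist _ _ unit_tens_positive).

End UnitClass.
End CuntzSemigroup.

(* Main.v *)
(* Let p = e ⊗ p_xi, w = [p] and x = [a] full. The point is that w <= n x for some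
   n: then r x̂ >= (r/n) ŵ, so r-comparison relative to x follows from
   r/n-comparison relative to w.

   For a positive a there is a positive T with T = a ⊕ T/4 ("infinitely many
   copies of a"); it is the norm limit of finite multiples D_n of a, whose classes
   are at most n x. Since [T] is an upper bound of the multiples of x and x is full,
   p ≾ T, so v T v† is close to p for some v, hence so is v D_n v†. A self-adjoint q
   with ‖p - q‖ < 1 satisfies c q c† = p for some c, which gives p ≾ D_n.

   That a full element exists is seen on T = p ⊕ T/4, whose class is the largest
   one: as e is a unit of A, the elements e ⊗ Q with Q a finite rank projection
   form an approximate unit, so x† x is a limit of elements x† (e ⊗ Q) x, and these
   are finite sums of elements y p y†, hence of the form v T v†. *)

From HB Require Import structures.
From mathcomp Require Import all_boot all_order all_algebra.
From mathcomp Require Import all_classical all_reals all_analysis.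
From mathcomp Require Import complex ring lra.
Require Import Defs.

Set Implicit Arguments.
Unset Strict Implicit.
Unset Printing Implicit Defensive.

Import Order.TTheory GRing.Theory Num.Theory.
Import numFieldNormedType.Exports.

Local Open Scope classical_set_scope.
Local Open Scope ring_scope.

(** * Real-valued norms and Banach's fixed point theorem *)

Section RealNorm.
Context {R : realType}.

(** The norm of a space over [R[i]] is a complex number; passing to its real part loses nothing by
    [normE] and puts all estimates into the ordered field [R]. *)
Definition nrm (V : normedZmodType R[i]) (x : V) : R := complex.Re `|x|.

Section Normed.
Context {V : normedZmodType R[i]}.
Implicit Types x y z : V.

Lemma normE x : `|x| = ((nrm x)%:C)%C.
Proof.
rewrite /nrm; case: `|x| (normr_ge0 x) => a b.
by rewrite lecE/= => /andP[/eqP -> _].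
Qed.

Lemma nrm_ge0 x : 0 <= nrm x.
Proof. by rewrite -lecR -normE normr_ge0. Qed.

Lemma nrm0 : nrm (0 : V) = 0.
Proof. by rewrite /nrm normr0. Qed.

Lemma nrm_eq0 x : nrm x = 0 -> x = 0.
Proof. by move=> h; apply/eqP; rewrite -normr_eq0 normE h. Qed.

Lemma nrmN x : nrm (- x) = nrm x.
Proof. by rewrite /nrm normrN. Qed.

Lemma nrmD x y : nrm (x + y) <= nrm x + nrm y.
Proof. by rewrite -lecR rmorphD/= -!normE ler_normD. Qed.

Lemma nrmB x y : nrm (x - y) <= nrm x + nrm y.
Proof. by rewrite -[nrm y]nrmN nrmD. Qed.

Lemma nrmC x y : nrm (x - y) = nrm (y - x).
Proof. by rewrite -nrmN opprB. Qed.

Lemma nrm_triangle z x y : nrm (x - y) <= nrm (x - z) + nrm (z - y).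
Proof. by rewrite -[x - y](subrKA z) nrmD. Qed.

Lemma nrm_lt_eq0 x : (forall eps, 0 < eps -> nrm x < eps) -> x = 0.
Proof.
move=> h; apply: nrm_eq0; apply/eqP; rewrite eq_le nrm_ge0 andbT leNgt.
by apply/negP => x0; have := h _ x0; rewrite ltxx.
Qed.

End Normed.

Lemma nrmZ (V : normedModType R[i]) (k : R[i]) (x : V) :
  nrm (k *: x) = complex.Re `|k| * nrm x.
Proof.
have h : forall z : R[i], `|z| = ((complex.Re `|z|)%:C)%C.
  by move=> z; rewrite [in LHS]normc_def [in RHS]normc_def.
by apply/complexI; rewrite rmorphM/= -h -!normE normrZ.
Qed.

Lemma nrmZ_real (V : normedModType R[i]) (k : R) (x : V) : 0 <= k ->
  nrm ((k%:C)%C *: x) = k * nrm x.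
Proof. by move=> k0; rewrite nrmZ ger0_norm// ler0c. Qed.

Lemma nrm_cvgP (V : normedModType R[i]) (u : nat -> V) (l : V) :
  u @ \oo --> l <->
  forall eps : R, 0 < eps -> exists N, forall n, (N <= n)%N -> nrm (l - u n) < eps.
Proof.
split=> [/cvgrPdist_lt h eps eps0|h].
  have [|N _ hN] := h (eps%:C)%C; first by rewrite -[0]/((0 : R)%:C)%C ltcR.
  by exists N => n /hN; rewrite /= normE ltcR.
apply/cvgrPdist_lt => e e0.
have [eR0 ->] : 0 < complex.Re e /\ e = ((complex.Re e)%:C)%C.
  by case: e e0 => er ei; rewrite ltcE/= => /andP[/eqP -> ->].
have [N hN] := h _ eR0; exists N => // n /= /hN.
by rewrite normE ltcR.
Qed.

Lemma nrm_ballP (V : normedModType R[i]) (x : V) (eps : R) (y : V) :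
  ball x (eps%:C)%C y <-> nrm (x - y) < eps.
Proof. by rewrite -ball_normE/= normE ltcR. Qed.

Lemma nrm_cauchy_cvg (V : completeNormedModType R[i]) (u : nat -> V) :
  (forall eps : R, 0 < eps -> exists N, forall n m, (N <= n)%N -> (N <= m)%N ->
    nrm (u n - u m) < eps) ->
  exists l : V, u @ \oo --> l.
Proof.
move=> h; suff /cvg_ex : cvg (u @ \oo) by [].
apply/cauchy_cvgP; apply: cauchy_exP => e e0.
have [eR0 ->] : 0 < complex.Re e /\ e = ((complex.Re e)%:C)%C.
  by case: e e0 => er ei; rewrite ltcE/= => /andP[/eqP -> ->].
have [N hN] := h _ eR0; exists (u N); exists N => // n /= Nn.
by apply/nrm_ballP/hN.
Qed.

Definition nrm_closed (V : normedModType R[i]) (P : set V) :=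
  forall x, (forall eps : R, 0 < eps -> exists2 y, P y & nrm (x - y) < eps) -> P x.

Lemma geometric_lt (C q eps : R) : 0 <= C -> 0 <= q < 1 -> 0 < eps ->
  exists N, forall n, (N <= n)%N -> C * q ^+ n < eps.
Proof.
move=> C0 /andP[q0 q1] eps0.
have : geometric C q @ \oo --> (0 : R) by apply: cvg_geometric; rewrite ger0_norm.
move=> /cvgrPdist_lt/(_ _ eps0)[N _ hN]; exists N => n /hN /=.
by rewrite sub0r normrN ger0_norm// mulr_ge0// exprn_ge0.
Qed.

(** Banach's fixed point theorem on a closed invariant set. It supplies square roots, inverses and
    infinite multiples without functional calculus. *)
Lemma contraction_fixpoint (V : completeNormedModType R[i]) (P : set V)
    (F : V -> V) (q : R) (x0 : V) : nrm_closed P -> P x0 ->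
  (forall x, P x -> P (F x)) -> 0 <= q < 1 ->
  (forall x y, P x -> P y -> nrm (F x - F y) <= q * nrm (x - y)) ->
  exists2 x, P x & F x = x.
Proof.
move=> clP P0 PF q01 cF; have /andP[q0 q1] := q01.
pose u n := iter n F x0.
have Pu n : P (u n) by elim: n => //= n; exact: PF.
(* [D] is the length of the first step and [C] the sum of the geometric series of all steps, so that
   [C * q ^+ n] bounds the tail from [n] on. *)
pose D := nrm (x0 - F x0); pose C := D / (1 - q).
have q1' : 0 < 1 - q by rewrite subr_gt0.
have D0 : 0 <= D := nrm_ge0 _.
have C0 : 0 <= C by rewrite divr_ge0// ltW.
have step n : nrm (u n - u n.+1) <= D * q ^+ n.
  elim: n => [|n IH]; first by rewrite expr0 mulr1.
  by rewrite exprS mulrCA (le_trans (cF _ _ (Pu n) (Pu n.+1)))// ler_wpM2l.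
have dist n m : nrm (u n - u (n + m)%N) <= C * q ^+ n.
  elim: m n => [|m IH] n.
    by rewrite addn0 subrr nrm0 mulr_ge0// exprn_ge0.
  rewrite addnS -addSn (le_trans (nrm_triangle (u n.+1) _ _))//.
  have := lerD (step n) (IH n.+1).
  rewrite exprS; suff -> : D * q ^+ n + C * (q * q ^+ n) = C * q ^+ n by [].
  by rewrite /C; field; rewrite gt_eqF.
have [|l ul] := @nrm_cauchy_cvg V u.
  move=> eps eps0; have [|N hN] := geometric_lt C0 q01 (_ : 0 < eps / 2).
    by rewrite divr_gt0.
  exists N => n m Nn Nm; rewrite (le_lt_trans (nrm_triangle (u N) _ _))//.
  rewrite -[n](subnKC Nn) -[m](subnKC Nm) [nrm (_ - u N)]nrmC.
  have h := hN _ (leqnn N).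
  have h1 := dist N (n - N)%N; have h2 := dist N (m - N)%N.
  lra.
have Pl : P l.
  apply: clP => eps /((nrm_cvgP _ _).1 ul)[N hN].
  by exists (u N) => //; exact: hN.
(* Both [F l] and [l] are close to [u N.+1 = F (u N)]. *)
exists l => //; apply/eqP; rewrite -subr_eq0; apply/eqP/nrm_lt_eq0 => eps eps0.
have [|N hN] := (nrm_cvgP _ _).1 ul (eps / 2); first by rewrite divr_gt0.
rewrite (le_lt_trans (nrm_triangle (u N.+1) _ _))// [nrm (_ - l)]nrmC.
have h1 := cF _ _ Pl (Pu N); have h2 := hN N.+1 (leqnSn _).
have h3 := hN N (leqnn _); have h4 : q * nrm (l - u N) <= nrm (l - u N).
  by rewrite ler_piMl ?nrm_ge0// ltW.
by rewrite /u/= in h1 h2 h3 h4 *; lra.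
Qed.

(** Self-adjointness and the conditions p s = s, t p = t are fixed point conditions of Lipschitz
    maps; this makes them admissible in [contraction_fixpoint]. *)
Lemma nrm_closed_fix (V : normedModType R[i]) (f : V -> V) (C : R) :
  (forall x y, nrm (f x - f y) <= C * nrm (x - y)) ->
  nrm_closed [set x | f x = x].
Proof.
move=> fC x hx /=; have C0 : 0 <= `|C| + 1 + 1 by rewrite !addr_ge0.
apply/eqP; rewrite -subr_eq0; apply/eqP/nrm_lt_eq0 => eps eps0.
have [|y /= fy xy] := hx (eps / (`|C| + 1 + 1)).
  by rewrite divr_gt0// !ltr_wpDl// addr_ge0.
rewrite (le_lt_trans (nrm_triangle y _ _))// -[X in nrm (_ - X)]fy fy.
move: xy; rewrite ltr_pdivlMr ?ltr_wpDl ?addr_ge0//.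
have h := fC x y; rewrite fy in h; rewrite [nrm (y - x)]nrmC.
have := ler_wpM2r (nrm_ge0 (x - y)) (ler_norm C).
have := nrm_ge0 (x - y); nra.
Qed.

Lemma nrm_closed_ball (V : normedModType R[i]) (C : R) :
  nrm_closed [set x : V | nrm x <= C].
Proof.
move=> x hx /=; apply/ler_addgt0Pr => eps /hx[y /= yC xy].
by have := nrmD y (x - y); rewrite addrCA subrr addr0; lra.
Qed.

Lemma nrm_closedI (V : normedModType R[i]) (P Q : set V) :
  nrm_closed P -> nrm_closed Q -> nrm_closed (P `&` Q).
Proof.
by move=> cP cQ x h; split; [apply: cP|apply: cQ] => eps /h[y [Py Qy] xy];
  exists y.
Qed.

End RealNorm.

(** * Norm estimates in a C*-algebra and perturbation of projections *)

Section CStarNorm.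
Context {R : realType} {B : cstarAlgType R}.
Implicit Types x y z a b c : B.

Lemma cmulNl x y : (- x) ** y = - (x ** y).
Proof. by apply: (addrI (x ** y)); rewrite -cmulDl !subrr cmul0r. Qed.

Lemma cmulBl x y z : (x - y) ** z = x ** z - y ** z.
Proof. by rewrite cmulDl cmulNl. Qed.

Lemma cmulBr x y z : x ** (y - z) = x ** y - x ** z.
Proof. by rewrite cmulDr cmulNr. Qed.

Lemma cstar0 : (0 : B)^† = 0.
Proof. by apply: (addrI (0 : B)^†); rewrite -cstarD !addr0. Qed.

Lemma cstarN x : (- x)^† = - x^†.
Proof. by apply: (addrI x^†); rewrite -cstarD !subrr cstar0. Qed.

Lemma cstarB x y : (x - y)^† = x^† - y^†.
Proof. by rewrite cstarD cstarN. Qed.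

Lemma cstarZ_real (k : R) x : ((k%:C)%C *: x)^† = (k%:C)%C *: x^†.
Proof. by rewrite cstarZ; congr (_ *: _); rewrite conj_Creal// complex_real. Qed.

Lemma nrmM x y : nrm (x ** y) <= nrm x * nrm y.
Proof. by rewrite -lecR rmorphM/= -!normE ler_normcM. Qed.

Lemma nrm_cstarM x : nrm (x^† ** x) = nrm x ^+ 2.
Proof.
by apply/complexI; rewrite rmorphXn/= -!normE cstar_identity.
Qed.

Lemma nrm_cstar x : nrm x^† = nrm x.
Proof.
suff h y : nrm y <= nrm y^† by apply/eqP; rewrite eq_le h -{2}(cstarK x) h.
have := nrm_ge0 y; rewrite le_eqVlt => /predU1P[<-|y0]; first exact: nrm_ge0.
by rewrite -(ler_pM2r y0) -expr2 -nrm_cstarM nrmM.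
Qed.

Lemma nrm_sandwich x y : nrm (x ** y ** x^†) <= nrm x ^+ 2 * nrm y.
Proof.
rewrite (le_trans (nrmM _ _))// nrm_cstar mulrC expr2 -mulrA ler_wpM2l ?nrm_ge0//.
exact: nrmM.
Qed.

Lemma nrm_projection (p : B) : p^† = p -> p ** p = p -> nrm p <= 1.
Proof.
move=> ps pp; have := nrm_cstarM p; rewrite ps pp => h.
have := nrm_ge0 p; rewrite le_eqVlt => /predU1P[<-//|p0].
by rewrite -(ler_pM2r p0) mul1r -expr2 -h.
Qed.

Lemma positive_cstar a : positive a -> a^† = a.
Proof. by move=> [x ->]; rewrite cstarM cstarK. Qed.

(* With p as unit of the corner, the fixed point of s |-> (d + s^2) / 2 satisfies
   (p - s)^2 = p - d. *)
Lemma corner_sqrt (p d : B) : p^† = p -> p ** p = p -> d^† = d -> p ** d = d ->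
  nrm d < 1 ->
  exists s : B, [/\ s^† = s, p ** s = s, nrm s <= nrm d & (p - s) ** (p - s) = p - d].
Proof.
move=> ps pp ds pd d1; pose h : R[i] := ((2^-1 : R)%:C)%C.
have h2 (x : B) : h *: x + h *: x = x.
  have half2 : (2^-1 : R) + 2^-1 = 1 by field.
  by rewrite -scalerDl -rmorphD half2 rmorph1 scale1r.
(* On the ball of radius ‖d‖ < 1 the map has Lipschitz constant ‖d‖, because x² - y² = x (x - y) +
   (x - y) y; the other two conditions place s in the corner of p. *)
pose P : set B := ([set s : B | s^† = s] `&` [set s : B | p ** s = s]) `&`
  [set s : B | nrm s <= nrm d].
have Psp s : P s -> s ** p = s.
  by move=> [[ss pss] _]; rewrite -{1}ss -{1}ps -cstarM pss.
have d0 := nrm_ge0 d.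
have [||s [[ss pss sd]]|||s [[/= ss pss] sd] fs] :=
    @contraction_fixpoint R B P (fun s => h *: (d + s ** s)) (nrm d) 0.
- apply: nrm_closedI; last exact: nrm_closed_ball.
  apply: nrm_closedI.
    by apply: (@nrm_closed_fix _ _ _ 1) => x y; rewrite -cstarB nrm_cstar mul1r.
  by apply: (@nrm_closed_fix _ _ _ (nrm p)) => x y; rewrite -cmulBr nrmM.
- by split; [split; rewrite /= ?cstar0 ?cmulr0|rewrite /= nrm0].
- split; [split|] => /=.
  + by rewrite cstarZ_real cstarD ds cstarM ss.
  + by rewrite cmulZr cmulDr pd cmulA pss.
  + rewrite nrmZ_real ?invr_ge0//; have := nrmD d (s ** s).
    by have := nrmM s s; have := nrm_ge0 s; rewrite /= in sd; nra.
- by rewrite d0.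
- move=> x y [_ /= xd] [_ /= yd]; rewrite -scalerBr nrmZ_real ?invr_ge0//.
  have -> : d + x ** x - (d + y ** y) = x ** (x - y) + (x - y) ** y.
    by rewrite cmulBr cmulBl subrKA opprD addrACA subrr add0r.
  have := nrmD (x ** (x - y)) ((x - y) ** y).
  have := nrmM x (x - y); have := nrmM (x - y) y; have := nrm_ge0 (x - y).
  by nra.
exists s; split=> //; rewrite cmulBl !cmulBr pp pss (Psp s)//.
have -> : d = s + s - s ** s by rewrite -{1 2}fs h2 addrK.
by rewrite !opprB opprD -!addrA; congr (_ + _); rewrite addrCA.
Qed.

(** Since ‖p - pqp‖ < 1, the element pqp has a square root p - s with ‖s‖ < 1. If t (p - s) = p,
    then t pqp t† = t (p - s) (p - s) t† = p, so c = t p works. *)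
Lemma projection_perturb (p q : B) : p^† = p -> p ** p = p -> q^† = q ->
  nrm (p - q) < 1 -> exists c, c ** q ** c^† = p.
Proof.
move=> ps pp qs pq1; pose d := p - p ** q ** p.
have p1 := nrm_projection ps pp.
have d1 : nrm d < 1.
  have -> : d = p ** (p - q) ** p^† by rewrite ps cmulBr cmulBl !pp.
  apply: le_lt_trans (nrm_sandwich _ _) (le_lt_trans _ pq1).
  by rewrite ler_piMl ?nrm_ge0// expr_le1// nrm_ge0.
have [//|//|||//|s [ss pss sd sq]] := @corner_sqrt p d.
- by rewrite cstarB !cstarM ps qs cmulA.
- by rewrite cmulBr !cmulA pp.
have sp : s ** p = s by rewrite -{1}ss -{1}ps -cstarM pss.
(* The inverse of p - s in the corner: the Neumann series p + s + s² + ... solves t = p + t s. *)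
have [|||||t /= tp ft] := @contraction_fixpoint R B [set t : B | t ** p = t]
    (fun t => p + t ** s) (nrm s) 0.
- apply: (@nrm_closed_fix _ _ _ (nrm p)) => x y; rewrite -cmulBl mulrC.
  exact: nrmM.
- by rewrite /= cmul0r.
- by move=> x /= xp; rewrite cmulDl pp -cmulA sp.
- by rewrite nrm_ge0 (le_lt_trans sd).
- by move=> x y _ _; rewrite opprD addrACA subrr add0r -cmulBl mulrC nrmM.
have tps : t ** (p - s) = p by rewrite cmulBr tp -{1}ft addrK.
have pst : (p - s) ** t^† = p.
  by have := congr1 cstar tps; rewrite cstarM cstarB ps ss.
exists (t ** p); rewrite cstarM ps !cmulA.
have -> : t ** p ** q ** p = t ** (p - s) ** (p - s).
  by rewrite -[RHS]cmulA sq /d opprB addrCA subrr addr0 !cmulA.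
by rewrite -cmulA pst tps pp.
Qed.

(** * Cuntz subequivalence *)

Lemma cuntz_leP a b : cuntz_le a b <->
  forall eps : R, 0 < eps -> exists w, nrm (a - w ** b ** w^†) < eps.
Proof.
split=> [[w /nrm_cvgP wa] eps /wa[N hN]|h].
  by exists (w N); exact: hN.
have /choice[w hw] : forall n : nat, exists w, nrm (a - w ** b ** w^†) < 2^-1 ^+ n.
  by move=> n; apply: h; rewrite exprn_gt0// invr_gt0.
exists w; apply/nrm_cvgP => eps eps0.
have [//||N hN] := @geometric_lt R 1 2^-1 eps _ _ eps0; first by lra.
by exists N => n Nn; rewrite (lt_trans (hw n))// -[X in X < _]mul1r hN.
Qed.

Lemma cuntz_le_trans b a c : cuntz_le a b -> cuntz_le b c -> cuntz_le a c.
Proof.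
move=> /cuntz_leP ab /cuntz_leP bc; apply/cuntz_leP => eps eps0.
have [|v av] := ab (eps / 2); first by rewrite divr_gt0.
have v0 : 0 < nrm v ^+ 2 + 1 by rewrite ltr_wpDl// sqr_ge0.
(* Conjugation by [v] magnifies the second error by at most ‖v‖², so its precision is fixed only
   after [v]; the added 1 covers v = 0. *)
have [|w bw] := bc (eps / 2 / (nrm v ^+ 2 + 1)); first by rewrite !divr_gt0.
exists (v ** w); rewrite (le_lt_trans (nrm_triangle (v ** b ** v^†) _ _))//.
have -> : v ** b ** v^† - v ** w ** c ** (v ** w)^† =
    v ** (b - w ** c ** w^†) ** v^†.
  by rewrite cstarM cmulBr cmulBl !cmulA.
have := nrm_sandwich v (b - w ** c ** w^†); move: bw.
rewrite ltr_pdivlMr//; have := nrm_ge0 (b - w ** c ** w^†).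
by nra.
Qed.

Lemma cuntz_le0 a : cuntz_le 0 a.
Proof.
by apply/cuntz_leP => eps eps0; exists 0; rewrite !cmul0r subrr nrm0.
Qed.

(** The factor is a square because the witness gets scaled by its root. Together with [cuntz_leZr]
    this makes the weight 1/4 in T = a ⊕ T/4 invisible to the Cuntz order. *)
Lemma cuntz_leZl (k : R) a b : cuntz_le a b -> cuntz_le (((k ^+ 2)%:C)%C *: a) b.
Proof.
move=> /cuntz_leP h; apply/cuntz_leP => eps eps0.
have k0 : 0 < k ^+ 2 + 1 by rewrite ltr_wpDl// sqr_ge0.
have [|w hw] := h (eps / (k ^+ 2 + 1)); first by rewrite divr_gt0.
exists ((k%:C)%C *: w).
rewrite cstarZ_real cmulZr !cmulZl scalerA -rmorphM/= -expr2 -scalerBr.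
rewrite nrmZ_real ?sqr_ge0//; move: hw; rewrite ltr_pdivlMr//.
by have := nrm_ge0 (a - w ** b ** w^†); nra.
Qed.

Lemma cuntz_leZr (k : R) a b : k != 0 -> cuntz_le a b ->
  cuntz_le a (((k ^+ 2)%:C)%C *: b).
Proof.
move=> k0 /cuntz_leP h; apply/cuntz_leP => eps /h[w hw].
exists (((k^-1)%:C)%C *: w).
rewrite cstarZ_real cmulZr !cmulZl cmulZr cmulZl !scalerA -!rmorphM/=.
by rewrite (_ : k^-1 * k^-1 * k ^+ 2 = 1) ?scale1r//; field.
Qed.

End CStarNorm.

(** * Conjugation by multipliers and isometries *)

Section Multipliers.
Context {R : realType} {B : cstarAlgType R}.
Variables (s t : B -> B) (st : adjointable s t).
Implicit Types a b : B.

Let sM a b : s (a ** b) = s a ** b.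
Proof. exact: adjointableM (adjointable_sym st). Qed.

Let sD a b : s (a + b) = s a + s b.
Proof. exact: adjointableD (adjointable_sym st). Qed.

Lemma adjointableZ (k : R[i]) a : s (k *: a) = k *: s a.
Proof.
by apply: cmulI_nondeg => z; rewrite -(adjointable_sym st) !cmulZr (adjointable_sym st).
Qed.

Lemma mult_conjD a b : mult_conj s (a + b) = mult_conj s a + mult_conj s b.
Proof. by rewrite /mult_conj cstarD sD cstarD sD. Qed.

Lemma mult_conjZ (k : R[i]) a : mult_conj s (k *: a) = k *: mult_conj s a.
Proof.
by rewrite /mult_conj cstarZ adjointableZ cstarZ conjCK adjointableZ.
Qed.

Lemma mult_conj_cstar a : (mult_conj s a)^† = mult_conj s a^†.
Proof.
have ts := adjointable_sym st.
rewrite /mult_conj cstarK; apply: cmulI_nondeg => z.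
by rewrite -cstarM -sM st cstarK -ts -cstarM sM.
Qed.

Hypothesis tsK : forall x, t (s x) = x.

Lemma mult_conjM a b : mult_conj s (a ** b) = mult_conj s a ** mult_conj s b.
Proof.
rewrite -[mult_conj s a]cstarK mult_conj_cstar {1 2}/mult_conj.
by rewrite st tsK cstarK -sM /mult_conj; congr s; rewrite cstarM sM cstarM cstarK.
Qed.

Lemma nrm_isometry a : nrm (s a) = nrm a.
Proof.
apply/eqP; rewrite -(@eqrXn2 _ 2) ?nrm_ge0//.
by rewrite -!nrm_cstarM st tsK.
Qed.

Lemma nrm_mult_conj a : nrm (mult_conj s a) = nrm a.
Proof. by rewrite /mult_conj nrm_isometry nrm_cstar nrm_isometry nrm_cstar. Qed.

End Multipliers.

(** The product is s a s† s' b s'†, and s† s' = 0. *)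
Lemma mult_conj_orth (R : realType) (B : cstarAlgType R) (s t s' t' : B -> B)
    (a b : B) : adjointable s t -> adjointable s' t' ->
  (forall x, t (s' x) = 0) -> mult_conj s a ** mult_conj s' b = 0.
Proof.
move=> st st' ts'.
by rewrite -[mult_conj s a]cstarK (mult_conj_cstar st) {1 2}/mult_conj st ts' cmulr0.
Qed.

(** * Direct sums inside the stabilization *)

Section DirectSum.
Context {R : realType} {A : cstarAlgType R} {AK : stabilization A}.
Implicit Types a b c d y w : st_alg AK.
Local Notation s1P := (st_s1P AK).
Local Notation s2P := (st_s2P AK).

Lemma dsumD a b c d : dsum (a + c) (b + d) = dsum a b + dsum c d.
Proof. by rewrite /dsum (mult_conjD s1P) (mult_conjD s2P) addrACA. Qed.

Lemma dsumZ (k : R[i]) a b : dsum (k *: a) (k *: b) = k *: dsum a b.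
Proof. by rewrite /dsum (mult_conjZ s1P) (mult_conjZ s2P) scalerDr. Qed.

Lemma dsumB a b c d : dsum (a - c) (b - d) = dsum a b - dsum c d.
Proof. by rewrite dsumD -(scaleN1r (dsum c d)) -dsumZ !scaleN1r. Qed.

Lemma dsumM a b c d : dsum a b ** dsum c d = dsum (a ** c) (b ** d).
Proof.
rewrite /dsum cmulDl !cmulDr (mult_conj_orth _ _ s1P s2P (@st_s12 _ _ AK)).
rewrite (mult_conj_orth _ _ s2P s1P (@st_s21 _ _ AK)) addr0 add0r.
by rewrite -(mult_conjM s1P (st_s1_isom AK)) -(mult_conjM s2P (st_s2_isom AK)).
Qed.

Lemma cstar_dsum a b : (dsum a b)^† = dsum a^† b^†.
Proof. by rewrite cstarD (mult_conj_cstar s1P) (mult_conj_cstar s2P). Qed.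

Lemma nrm_dsum a b : nrm (dsum a b) <= nrm a + nrm b.
Proof.
rewrite (le_trans (nrmD _ _))// (nrm_mult_conj s1P (st_s1_isom AK)).
by rewrite (nrm_mult_conj s2P (st_s2_isom AK)).
Qed.

Lemma cuntz_le_dsum a b c d :
  cuntz_le a c -> cuntz_le b d -> cuntz_le (dsum a b) (dsum c d).
Proof.
move=> /cuntz_leP ac /cuntz_leP bd; apply/cuntz_leP => eps eps0.
have [|v vP] := ac (eps / 2); first by rewrite divr_gt0.
have [|w wP] := bd (eps / 2); first by rewrite divr_gt0.
exists (dsum v w); rewrite cstar_dsum !dsumM -dsumB.
by rewrite (le_lt_trans (nrm_dsum _ _))//; lra.
Qed.

(* The square root of [T = a ⊕ T/4] is obtained as the fixed point of
   [Y |-> x ⊕ Y/2], where [a = x† x]. *)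
Lemma infinite_multiple a : positive a ->
  exists2 T, positive T & T = dsum a (((2^-1 ^+ 2)%:C)%C *: T).
Proof.
move=> [x ->]; pose h : R[i] := ((2^-1 : R)%:C)%C.
have [|//|//||y z _ _|Y _ fY] := @contraction_fixpoint R (st_alg AK) setT
  (fun Y => dsum x (h *: Y)) 2^-1 0; first by [].
- by lra.
- rewrite -dsumB -scalerBr subrr (le_trans (nrm_dsum _ _))// nrm0 add0r.
  by rewrite nrmZ_real ?invr_ge0.
exists (Y^† ** Y); first by exists Y.
rewrite -{1 2}fY cstar_dsum dsumM cstarZ_real cmulZl cmulZr scalerA.
by rewrite -rmorphM/= -expr2.
Qed.

(* The row [(y, w)] is the element [y s1† + w s2†]. *)
Lemma dsum_row_conj y w a b :
  exists v, v ** dsum a b ** v^† = y ** a ** y^† + w ** b ** w^†.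
Proof.
exists ((st_s1 AK y^†)^† + (st_s2 AK w^†)^†).
(* In multiplier notation, (z s†) (s c s†) = z c s†. *)
have row s t : adjointable s t -> (forall x, t (s x) = x) ->
    forall z c : st_alg AK, (s z^†)^† ** mult_conj s c = (s (z ** c)^†)^†.
  move=> st ts z c; rewrite /mult_conj st ts -cstarM.
  by rewrite -(adjointableM _ _ (adjointable_sym st)) -cstarM.
have -> : ((st_s1 AK y^†)^† + (st_s2 AK w^†)^†) ** dsum a b =
    (st_s1 AK (y ** a)^†)^† + (st_s2 AK (w ** b)^†)^†.
  rewrite /dsum cmulDl !cmulDr (row _ _ s1P (st_s1_isom AK)).
  rewrite (row _ _ s2P (st_s2_isom AK)) {1 2}/mult_conj.
  by rewrite s2P st_s21 s1P st_s12 !cmulr0 addr0 add0r.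
rewrite cstarD !cstarK cmulDl !cmulDr.
rewrite !s1P !s2P st_s1_isom st_s2_isom st_s12 st_s21 !cmulr0 addr0 add0r.
by rewrite !cstarK.
Qed.

Lemma cuntz_le_dsuml a b c : cuntz_le a b -> cuntz_le a (dsum b c).
Proof.
move=> /cuntz_leP ab; apply/cuntz_leP => eps /ab[w hw].
have [v vE] := dsum_row_conj w 0 b c; exists v.
by rewrite vE !cmul0r addr0.
Qed.

(** The row (y, 2w) applied to T = p ⊕ T/4, where 2 compensates the weight 1/4. By iteration every
    finite sum of terms y p y† has the form v T v†. *)
Lemma infinite_multiple_absorb (p T y w : st_alg AK) :
  T = dsum p (((2^-1 ^+ 2)%:C)%C *: T) ->
  exists v, v ** T ** v^† = y ** p ** y^† + w ** T ** w^†.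
Proof.
move=> TE.
have [v vE] := dsum_row_conj y (((2 : R)%:C)%C *: w) p (((2^-1 ^+ 2)%:C)%C *: T).
exists v; rewrite {1}TE vE; congr (_ + _).
rewrite cstarZ_real cmulZr !cmulZl cmulZr cmulZl !scalerA -!(rmorphM (real_complex R)).
have -> : 2 * 2 * 2^-1 ^+ 2 = 1 :> R by field.
by rewrite rmorph1 scale1r.
Qed.

End DirectSum.

(** * Finite rank projections and approximation of compact operators *)

Section OrthonormalFamilies.
Context {R : realType} {H : hilbertType R}.
Implicit Types (x y z xi : H) (xs cs : seq H) (T L : H -> H).

Definition linear_op (T : H -> H) : Prop :=
  forall (k : R[i]) x y, T (k *: x + y) = k *: T x + T y.

Lemma linear_op0 T : linear_op T -> T 0 = 0.
Proof.
move=> lT; apply: (addrI (T 0)); have := lT 1 0 0.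
by rewrite !scale1r !addr0.
Qed.

Lemma linear_opZ T (k : R[i]) x : linear_op T -> T (k *: x) = k *: T x.
Proof. by move=> lT; have := lT k x 0; rewrite !addr0 (linear_op0 lT) addr0. Qed.

Lemma linear_opB T x y : linear_op T -> T (x - y) = T x - T y.
Proof. by move=> lT; rewrite addrC -scaleN1r lT scaleN1r addrC. Qed.

Lemma hdot0l x : hdot 0 x = 0.
Proof. by rewrite -(scale0r 0) hdotZl mul0r. Qed.

Lemma hdotBl x y z : hdot (x - y) z = hdot x z - hdot y z.
Proof. by rewrite hdotDl -scaleN1r hdotZl mulN1r. Qed.

Lemma hdotBr x y z : hdot x (y - z) = hdot x y - hdot x z.
Proof. by rewrite hdotC hdotBl rmorphB/= -!hdotC. Qed.

Definition orthonormal xs : bool :=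
  all (fun x => `|x| == 1) xs && pairwise (fun x y => hdot x y == 0) xs.

Definition span_proj xs : H -> H := fun z => \sum_(x <- xs) rank_one_proj x z.

Lemma orthonormal_cons x xs : orthonormal (x :: xs) ->
  [/\ `|x| = 1, orthonormal xs & forall y, y \in xs -> hdot y x = 0].
Proof.
rewrite /orthonormal/= => /andP[/andP[/eqP x1 ->] /andP[/allP xxs ->]].
by split=> // y /xxs /eqP xy; rewrite hdotC xy conjC0.
Qed.

Lemma span_proj_cons x xs z :
  span_proj (x :: xs) z = hdot z x *: x + span_proj xs z.
Proof. by rewrite /span_proj big_cons. Qed.

Lemma span_proj_linear xs : linear_op (span_proj xs).
Proof.
move=> k y z; rewrite /span_proj scaler_sumr -big_split/=; apply: eq_bigr => x _.
by rewrite /rank_one_proj hdotDl hdotZl scalerDl scalerA.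
Qed.

Lemma hdot_span_proj x xs z : (forall y, y \in xs -> hdot y x = 0) ->
  hdot (span_proj xs z) x = 0.
Proof.
elim: xs => [|y xs IH] h; first by rewrite /span_proj big_nil hdot0l.
rewrite span_proj_cons hdotDl hdotZl h ?mem_head// mulr0 add0r IH// => w wxs.
by rewrite h// in_cons wxs orbT.
Qed.

Lemma nrm_sub_rank_one_proj xi z : `|xi| = 1 ->
  nrm (z - rank_one_proj xi z) <= nrm z.
Proof.
move=> xi1; rewrite -(@ler_pXn2r _ 2) ?nnegrE ?nrm_ge0// -lecR !rmorphXn/= -!normE.
rewrite -!hdotxx /rank_one_proj hdotBr !hdotBl !hdotZl !hdotZr (hdotxx xi) xi1.
rewrite [hdot xi z]hdotC expr1n mulr1 [_^* * _]mulrC subrr subr0 -normCK.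
by rewrite lerBlDr lerDl exprn_ge0.
Qed.

(** Vectors are split off one at a time: as x is orthogonal to the span of xs, the defect for x ::
    xs is obtained from the defect for xs by subtracting its component along x. *)
Lemma nrm_sub_span_proj xs z : orthonormal xs ->
  nrm (z - span_proj xs z) <= nrm z.
Proof.
elim: xs => [|x xs IH]; first by rewrite /span_proj big_nil subr0.
move=> /orthonormal_cons[x1 oxs xxs].
apply: le_trans (IH oxs); rewrite span_proj_cons.
have -> : hdot z x = hdot (z - span_proj xs z) x.
  by rewrite hdotBl (hdot_span_proj _ xxs) subr0.
by rewrite opprD addrA addrAC; exact: nrm_sub_rank_one_proj.
Qed.

(** The crude constant 2 suffices, as only boundedness enters the compactness of P T. *)
Lemma nrm_span_proj xs z : orthonormal xs -> nrm (span_proj xs z) <= 2 * nrm z.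
Proof.
move=> /(nrm_sub_span_proj z) h; rewrite -[span_proj xs z](subKr z).
by have := nrmB z (z - span_proj xs z); lra.
Qed.

Lemma hdot_sub_span_proj xs x z : orthonormal xs -> x \in xs ->
  hdot (z - span_proj xs z) x = 0.
Proof.
elim: xs => [//|y xs IH] /orthonormal_cons[y1 oxs yxs].
rewrite in_cons span_proj_cons opprD addrCA addrC => /predU1P[->|xxs].
  rewrite hdotBl hdotZl hdotxx y1 expr1n mulr1 hdotBl (hdot_span_proj _ yxs).
  by rewrite subr0 subrr.
by rewrite hdotBl hdotZl [hdot y x]hdotC (yxs _ xxs) conjC0 mulr0 subr0 IH.
Qed.

Lemma gram_schmidt cs : exists2 xs, orthonormal xs &
  forall c, c \in cs -> span_proj xs c = c.
Proof.
elim: cs => [|c cs [xs oxs hxs]]; first by exists [::].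
pose d := c - span_proj xs c.
have [d0|d0] := eqVneq d 0.
  exists xs => // c'; rewrite in_cons => /predU1P[->|/hxs//].
  by apply/esym/eqP; rewrite -subr_eq0 -/d d0.
have nd0 : nrm d != 0 by apply: contra d0 => /eqP/nrm_eq0 ->.
pose xi := (((nrm d)^-1)%:C)%C *: d.
have dxi : (((nrm d))%:C)%C *: xi = d by rewrite scalerA -rmorphM/= divff// scale1r.
have xsxi x : x \in xs -> hdot x xi = 0.
  by move=> xxs; rewrite hdotZr [hdot x d]hdotC hdot_sub_span_proj// conjC0 mulr0.
(* c is the sum of d = ‖d‖ xi and a vector of the old span, which is orthogonal to xi. *)
have cxi : hdot c xi = ((nrm d)%:C)%C.
  rewrite -[c](subrK (span_proj xs c)) hdotDl (hdot_span_proj _ xsxi) addr0 -/d.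
  rewrite hdotZr hdotxx normE conj_Creal ?complex_real// -rmorphXn -rmorphM/=.
  by rewrite expr2 mulKf.
exists (xi :: xs).
  move: oxs; rewrite /orthonormal/= => /andP[-> ->].
  rewrite !andbT normE nrmZ_real ?invr_ge0 ?nrm_ge0// mulVf// eqxx/=.
  by apply/allP => x /xsxi xxi; rewrite hdotC xxi conjC0.
move=> c'; rewrite in_cons span_proj_cons => /predU1P[->|/hxs c'E].
  by rewrite cxi dxi subrK.
by rewrite -{1}c'E (hdot_span_proj _ xsxi) scale0r add0r.
Qed.

Lemma compact_comp L T (C : R) : linear_op L ->
  (forall z, nrm (L z) <= C * nrm z) -> compact_op T -> compact_op (L \o T).
Proof.
move=> lL LC [lT [K KT [cK clK]]]; split.
  by move=> k x y /=; rewrite lT lL.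
have cL : continuous L.
  move=> x; apply/cvgrPdist_lt => e e0.
  have [eR0 eE] : 0 < complex.Re e /\ e = ((complex.Re e)%:C)%C.
    by case: e e0 => er ei; rewrite ltcE/= => /andP[/eqP -> ->].
  have C0 : 0 < `|C| + 1 by rewrite ltr_wpDl.
  apply/nbhs_ballP; exists ((complex.Re e / (`|C| + 1))%:C)%C.
    by rewrite /= ltcR divr_gt0.
  move=> y /nrm_ballP; rewrite ltr_pdivlMr// => xy.
  rewrite /= -linear_opB// normE eE ltcR (le_lt_trans _ xy)// (le_trans (LC _))//.
  by rewrite mulrC ler_wpM2l ?nrm_ge0// ler_wpDr// ler_norm.
have cLK : compact (L @` K).
  by apply: continuous_compact => //; exact: continuous_subspaceT.
apply: precompact_subset (compact_precompact (@norm_hausdorff _ _) cLK).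
by move=> _ [x /= x1 <-]; exists (T x) => //; apply: KT; exists x.
Qed.

(** Total boundedness, from a finite subcover by balls of radius d of a compact set containing the
    image of the unit ball. *)
Lemma compact_net T (d : R) : compact_op T -> 0 < d ->
  exists cs : seq H, forall x, nrm x <= 1 -> exists2 c, c \in cs & nrm (T x - c) < d.
Proof.
move=> [_ [K KT [cK _]]] d0; move: cK; rewrite compact_cover.
move=> /(_ H setT (fun c => ball c (d%:C)%C))[].
- by move=> c _; apply: ball_open; rewrite ltcR.
- by move=> x _; exists x => //; apply: ballxx; rewrite ltcR.
move=> D _ hD; exists (finmap.enum_fset D) => x x1.
have [|c cD /nrm_ballP xc] := hD (T x).
  by apply: KT; exists x => //=; rewrite normE lecR.
by exists c => //; rewrite nrmC.
Qed.

(** If P fixes a net point c near T y, then (1 - P) T y = (1 - P) (T y - c) is small. Allowing every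
    P that fixes [cs] makes it possible to merge the nets of several operators. *)
Lemma compact_op_approx T (d : R) : compact_op T -> 0 < d ->
  exists cs : seq H, forall xs, orthonormal xs ->
    (forall c, c \in cs -> span_proj xs c = c) ->
    forall x, nrm (T x - span_proj xs (T x)) <= d * nrm x.
Proof.
move=> cT d0; have [cs hcs] := compact_net cT d0; have [lT _] := cT.
exists cs => xs oxs hxs x; have lP := span_proj_linear xs.
have [->|x0] := eqVneq x 0.
  by rewrite (linear_op0 lT) (linear_op0 lP) subrr nrm0 mulr0.
have nx0 : nrm x != 0 by apply: contra x0 => /eqP/nrm_eq0 ->.
pose k : R[i] := ((nrm x)%:C)%C; pose y := (((nrm x)^-1)%:C)%C *: x.
have xE : x = k *: y by rewrite scalerA -rmorphM/= divff// scale1r.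
have [|c /hxs cE yc] := hcs y.
  by rewrite nrmZ_real ?invr_ge0 ?nrm_ge0// mulVf.
have -> : T x - span_proj xs (T x) = k *: ((T y - c) - span_proj xs (T y - c)).
  rewrite xE (linear_opZ _ _ lT) (linear_opZ _ _ lP) -scalerBr (linear_opB _ _ lP).
  by rewrite cE opprB addrA subrK.
rewrite nrmZ_real ?nrm_ge0// mulrC ler_wpM2r ?nrm_ge0//.
exact: le_trans (nrm_sub_span_proj _ oxs) (ltW yc).
Qed.

End OrthonormalFamilies.

(** * An approximate unit of projections, and the largest Cuntz class *)

Section ApproximateUnit.
Context {R : realType} {A : cstarAlgType R} {AK : stabilization A}.
Variables (e : A) (hunit : is_unit_of e).
Local Notation H := (st_hilb AK).
Implicit Types (xs cs : seq H) (T : H -> H) (a : A) (b : st_alg AK).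

Lemma unit_cstar : e^† = e.
Proof.
have := (hunit e^†).1; have := congr1 cstar (hunit e^†).1.
by rewrite cstarM cstarK => h1 h2; rewrite -h2 h1.
Qed.

(** The tensor laws hold for compact operators, so zero is written as 0 T with T compact. *)
Lemma st_tens0r a T : compact_op T -> st_tens AK a (fun=> 0) = 0.
Proof.
move=> cT; rewrite -(scale0r (st_tens AK a T)) -st_tensZr//; congr st_tens.
by apply/funext => x; rewrite scale0r.
Qed.

(** For orthonormal [xs] this is e ⊗ P with P the projection onto their span, kept as a sum so that
    it can be absorbed term by term. *)
Definition tens_proj xs : st_alg AK :=
  \sum_(x <- xs) st_tens AK e (rank_one_proj x).

Lemma tens_proj_cons x xs :
  tens_proj (x :: xs) = st_tens AK e (rank_one_proj x) + tens_proj xs.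
Proof. by rewrite /tens_proj big_cons. Qed.

Lemma span_proj_compact_comp xs T : orthonormal xs -> compact_op T ->
  compact_op (span_proj xs \o T).
Proof.
move=> oxs cT; apply: (compact_comp (span_proj_linear xs) _ cT (C := 2)) => z.
exact: nrm_span_proj.
Qed.

Lemma tens_projM xs a T : orthonormal xs -> compact_op T ->
  tens_proj xs ** st_tens AK a T = st_tens AK a (span_proj xs \o T).
Proof.
move=> + cT; elim: xs => [_|x xs IH oxxs].
  rewrite /tens_proj big_nil cmul0r -(st_tens0r a cT); congr st_tens.
  by apply/funext => z; rewrite /span_proj/= big_nil.
have [x1 oxs _] := orthonormal_cons oxxs.
have x1P : rank_one_proj x \o T = span_proj [:: x] \o T.
  by apply/funext => z; rewrite /span_proj/= big_seq1.
have ox : orthonormal [:: x] by rewrite /orthonormal/= x1 eqxx.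
rewrite tens_proj_cons cmulDl IH// st_tensM ?(hunit a).1//; last first.
  exact: rank_one_proj_compact.
rewrite -st_tensDr; last exact: span_proj_compact_comp.
  by congr st_tens; apply/funext => z; rewrite /= span_proj_cons.
by rewrite x1P; exact: span_proj_compact_comp.
Qed.

Lemma tens_proj_cstar xs : orthonormal xs -> (tens_proj xs)^† = tens_proj xs.
Proof.
elim: xs => [_|x xs IH /orthonormal_cons[x1 oxs _]].
  by rewrite /tens_proj big_nil cstar0.
have cx := rank_one_proj_compact x1.
rewrite tens_proj_cons cstarD IH//; congr (_ + _).
by rewrite (st_tens_star _ cx cx (rank_one_proj_adj x)) unit_cstar.
Qed.

Lemma tens_proj_idem xs : orthonormal xs ->
  tens_proj xs ** tens_proj xs = tens_proj xs.
Proof.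
elim: xs => [_|x xs IH oxxs]; first by rewrite /tens_proj big_nil cmul0r.
have [x1 oxs xxs] := orthonormal_cons oxxs.
have cx := rank_one_proj_compact x1.
have px : tens_proj xs ** st_tens AK e (rank_one_proj x) = 0.
  rewrite tens_projM// -(st_tens0r e cx); congr st_tens; apply/funext => z /=.
  rewrite /rank_one_proj (linear_opZ _ _ (span_proj_linear xs)).
  rewrite [span_proj xs x]big_seq big1 ?scaler0// => y yxs.
  by rewrite /rank_one_proj hdotC xxs// conjC0 scale0r.
(* The other cross term vanishes by taking adjoints. *)
have xp := congr1 cstar px.
rewrite cstarM tens_proj_cstar// (st_tens_star _ cx cx (rank_one_proj_adj x)) in xp.
rewrite unit_cstar cstar0 in xp.
rewrite tens_proj_cons cmulDl !cmulDr px xp addr0 add0r IH//.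
by rewrite st_tensM// (hunit e).1 rank_one_proj_idem.
Qed.

Lemma nrm_tens_proj xs : orthonormal xs -> nrm (tens_proj xs) <= 1.
Proof.
by move=> o; apply: nrm_projection; [exact: tens_proj_cstar|exact: tens_proj_idem].
Qed.

(** Quantifying over all spans containing [cs] makes the property stable under sums: two finite sets
    are concatenated. *)
Definition proj_approximable b : Prop := forall eps : R, 0 < eps ->
  exists cs, forall xs, orthonormal xs ->
    (forall c, c \in cs -> span_proj xs c = c) ->
    nrm (b - tens_proj xs ** b) <= eps.

Lemma proj_approximable_tens a T : compact_op T ->
  proj_approximable (st_tens AK a T).
Proof.
move=> cT eps eps0; have a0 : 0 < nrm a + 1 by rewrite ltr_wpDl// nrm_ge0.
have [cs hcs] := compact_op_approx cT (divr_gt0 eps0 a0).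
exists cs => xs oxs /(hcs _ oxs) hT; rewrite tens_projM//.
have cPT := span_proj_compact_comp oxs cT.
have cQT : compact_op (fun z => T z - span_proj xs (T z)).
  apply: (@compact_comp _ _ (fun z => z - span_proj xs z) T 1) => // [k y z|z].
    by rewrite span_proj_linear scalerBr opprD addrACA.
  by rewrite mul1r nrm_sub_span_proj.
have {1}-> : T = fun z => (T z - span_proj xs (T z)) + (span_proj xs \o T) z.
  by apply/funext => z; rewrite /= subrK.
rewrite st_tensDr// addrK.
have := @st_tens_norm _ _ AK a _ ((eps / (nrm a + 1))%:C)%C cQT.
rewrite !normE -rmorphM/= lecR => /(_ _)/le_trans-> //.
  by move=> z; rewrite !normE -rmorphM/= lecR.
by rewrite mulrCA ler_piMr ?(ltW eps0)// ler_pdivrMr// mul1r lerDl.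
Qed.

Lemma proj_approximableD b b' :
  proj_approximable b -> proj_approximable b' -> proj_approximable (b + b').
Proof.
move=> hb hb' eps eps0; have eps2 : 0 < eps / 2 by rewrite divr_gt0.
have [cs hcs] := hb _ eps2; have [cs' hcs'] := hb' _ eps2.
exists (cs ++ cs') => xs oxs fxs; rewrite cmulDr opprD addrACA.
rewrite (le_trans (nrmD _ _))// [leRHS](splitr eps) lerD//.
  by apply: hcs => // c h; rewrite fxs// mem_cat h.
by apply: hcs' => // c h; rewrite fxs// mem_cat h orbT.
Qed.

(** Elementary tensors have dense span, and passing to the limit is harmless because ‖e ⊗ P‖ <=
    1. *)
Lemma all_proj_approximable b : proj_approximable b.
Proof.
move=> eps eps0; have eps3 : 0 < eps / 3 by rewrite divr_gt0.
have [|b' [/nrm_ballP bb' [n [a [T [cT b'E]]]]]] :=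
    @st_tens_dense _ _ AK (ball b ((eps / 3)%:C)%C) _ (ball_open _ _).
  by exists b; apply: ballxx; rewrite ltcR.
have [|cs hcs] := (_ : proj_approximable b') _ eps3.
  rewrite b'E; apply: big_ind => [d d0|x y|i _]; last exact: proj_approximable_tens.
    by exists [::] => xs _ _; rewrite cmulr0 subrr nrm0 ltW.
  exact: proj_approximableD.
exists cs => xs oxs /(hcs _ oxs) h.
rewrite (le_trans (nrm_triangle b' _ _))//.
rewrite (le_trans (lerD (lexx _) (nrm_triangle (tens_proj xs ** b') _ _)))//.
rewrite -cmulBr; have h1 := nrmM (tens_proj xs) (b' - b).
have h2 := ler_piMl (nrm_ge0 (b' - b)) (nrm_tens_proj oxs).
by rewrite [nrm (b' - b)]nrmC in h1 h2; lra.
Qed.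

Lemma approximate_unit b (eps : R) : 0 < eps ->
  exists2 xs, orthonormal xs & nrm (b - tens_proj xs ** b) <= eps.
Proof.
move=> /(all_proj_approximable b)[cs hcs].
by have [xs oxs /(hcs _ oxs) h] := gram_schmidt cs; exists xs.
Qed.

(** Witnesses must lie in the algebra itself, so an approximate unit u replaces 1: u b is close to
    b, and b u† is close to b by adjoints. *)
Lemma cuntz_le_refl b : positive b -> cuntz_le b b.
Proof.
move=> /positive_cstar bs; apply/cuntz_leP => eps eps0.
have [|xs oxs h] := @approximate_unit b (eps / 3); first by rewrite divr_gt0.
exists (tens_proj xs); set u := tens_proj xs in h *.
have us : u^† = u := tens_proj_cstar oxs.
rewrite (le_lt_trans (nrm_triangle (u ** b) _ _))// -[_ ** b ** _]cmulA -cmulBr.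
have h1 : nrm (b - b ** u^†) <= eps / 3 by rewrite -nrm_cstar cstarB cstarM cstarK bs.
have h2 := nrmM u (b - b ** u^†).
have h3 := ler_piMl (nrm_ge0 (b - b ** u^†)) (nrm_tens_proj oxs).
by lra.
Qed.

Section Absorption.
Variables (xi : H) (xi1 : `|xi| = 1) (T : st_alg AK).
Hypothesis TE :
  T = dsum (st_tens AK e (rank_one_proj xi)) (((2^-1 ^+ 2)%:C)%C *: T).

(** All rank one projections are equivalent: v = e ⊗ V for the partial isometry V taking xi to x. *)
Lemma tens_rank_one_conj x : `|x| = 1 -> exists v,
  st_tens AK e (rank_one_proj x) =
    v ** st_tens AK e (rank_one_proj xi) ** v^†.
Proof.
move=> x1; pose V z w : H -> H := fun y => hdot y z *: w.
have cV z w : `|z| = 1 -> `|w| = 1 -> compact_op (V z w).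
  (* Compactness is inherited from the projection onto z. *)
  move=> z1 w1; have -> : V z w = V z w \o rank_one_proj z.
    by apply/funext => y; rewrite /V/= hdotZl hdotxx z1 expr1n mulr1.
  apply: (@compact_comp _ _ (V z w) _ 1 _ _ (rank_one_proj_compact z1)).
    by move=> k y y'; rewrite /V hdotDl hdotZl scalerDl scalerA.
  move=> y; rewrite mul1r -lecR -!normE /V normrZ w1 mulr1.
  exact: hdot_unit_le.
exists (st_tens AK e (V xi x)).
have cx := cV _ _ xi1 x1; have cx' := cV _ _ x1 xi1.
rewrite (@st_tens_star _ _ AK _ _ (V x xi))//; last first.
  by move=> y y'; rewrite /V hdotZl hdotZr -hdotC mulrC.
have cxi := rank_one_proj_compact xi1.
have cV' : compact_op (V xi x \o rank_one_proj xi).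
  have -> // : V xi x \o rank_one_proj xi = V xi x.
  by apply/funext => y; rewrite /V/= hdotZl hdotxx xi1 expr1n mulr1.
rewrite unit_cstar !st_tensM// !(hunit e).1; congr st_tens; apply/funext => y.
by rewrite /V /rank_one_proj /= !hdotZl hdotxx xi1 expr1n !mulr1.
Qed.

(** Each summand contributes b† y p y† b, which is absorbed into T. *)
Lemma absorb_tens_proj xs b : orthonormal xs -> exists v,
  b^† ** tens_proj xs ** b = v ** T ** v^†.
Proof.
elim: xs => [_|x xs IH /orthonormal_cons[x1 oxs _]].
  by exists 0; rewrite /tens_proj big_nil cmulr0 !cmul0r.
have [w wE] := IH oxs; have [y yE] := tens_rank_one_conj x1.
have [v vE] := infinite_multiple_absorb (b^† ** y) w TE; exists v.
by rewrite vE tens_proj_cons cmulDr cmulDl wE yE cstarM cstarK !cmulA.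
Qed.

Lemma cuntz_le_infinite b : positive b -> cuntz_le b T.
Proof.
move=> [x ->]; apply/cuntz_leP => eps eps0.
have x0 : 0 < nrm x + 1 by rewrite ltr_wpDl// nrm_ge0.
have eps2 : 0 < eps / 2 by rewrite divr_gt0.
(* The error is later multiplied by ‖x†‖ = ‖x‖; halving [eps] makes the final bound strict. *)
have [xs oxs h] := approximate_unit x (divr_gt0 eps2 x0).
have [v vE] := absorb_tens_proj x oxs.
exists v; rewrite -vE -[x^† ** _ ** x]cmulA -cmulBr (le_lt_trans (nrmM _ _))//.
rewrite nrm_cstar; move: h; rewrite ler_pdivlMr//.
have := nrm_ge0 x; have := nrm_ge0 (x - tens_proj xs ** x).
by nra.
Qed.

End Absorption.
End ApproximateUnit.

(** * The order of the Cuntz semigroup, and multiples of a class *)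

Section CuntzSemigroupOrder.
Context {R : realType} {A : cstarAlgType R} {AK : stabilization A}.
Variables (e : A) (hunit : is_unit_of e).
Implicit Types (a b T : pos_elt AK) (x y : Cu AK).

Lemma cu_class_le a b : cu_class a = cu_class b -> cuntz_le (sval a) (sval b).
Proof.
move=> /(congr1 sval)/= h.
have : cuntz_class_set a a.
  by split; apply: (cuntz_le_refl hunit); exact: (svalP a).
by rewrite h => -[].
Qed.

(** [cu_le] only asks for some pair of representatives; transitivity carries the relation to any
    other pair. *)
Lemma cu_leP a b : cu_le (cu_class a) (cu_class b) <-> cuntz_le (sval a) (sval b).
Proof.
split=> [[a' [b' [aa' bb' ab]]]|ab]; last by exists a, b.
apply: cuntz_le_trans (cu_class_le aa') _.
by apply: cuntz_le_trans ab (cu_class_le (esym bb')).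
Qed.

Lemma cu_reprK x : cu_class (cu_repr x) = x.
Proof.
case: x => X hX; rewrite /cu_repr; case: cid => a /= aX; subst X.
by congr exist; exact: Prop_irrelevance.
Qed.

Lemma cu_repr_class a :
  cuntz_le (sval a) (sval (cu_repr (cu_class a))) /\
  cuntz_le (sval (cu_repr (cu_class a))) (sval a).
Proof. by split; apply: cu_class_le; rewrite cu_reprK. Qed.

Lemma cu_le_trans y x z : cu_le x y -> cu_le y z -> cu_le x z.
Proof.
rewrite -(cu_reprK x) -(cu_reprK y) -(cu_reprK z) !cu_leP.
exact: cuntz_le_trans.
Qed.

Lemma cu_le_addr x y : cu_le x (cu_add x y).
Proof.
rewrite -{1}(cu_reprK x); apply/cu_leP; apply: cuntz_le_dsuml.
by apply: (cuntz_le_refl hunit); exact: (svalP (cu_repr x)).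
Qed.

(** Inductively, x + n x <= [a ⊕ T] <= [a ⊕ T/4] = [T]. *)
Lemma cu_muln_le_infinite_multiple x T n :
  sval T = dsum (sval (cu_repr x)) (((2^-1 ^+ 2)%:C)%C *: sval T) ->
  cu_le (om_muln n x) (cu_class T).
Proof.
move=> TE; elim: n => [|n]; first by apply/cu_leP; exact: cuntz_le0.
rewrite -{1}(cu_reprK (om_muln n x)) => /cu_leP IH.
apply/cu_leP; rewrite TE; apply: cuntz_le_dsum.
  by apply: (cuntz_le_refl hunit); exact: (svalP (cu_repr x)).
by apply: cuntz_le_trans IH _; apply: cuntz_leZr; [exact: invr_neq0|
  apply: (cuntz_le_refl hunit); exact: (svalP T)].
Qed.

(** The truncations c ⊕ (c/4 ⊕ ...) of T; the decreasing weights give norm convergence. *)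
Definition finite_multiple (c : st_alg AK) n : st_alg AK :=
  iter n (fun D => dsum c (((2^-1 ^+ 2)%:C)%C *: D)) 0.

Lemma finite_multiple_le x n :
  cuntz_le (finite_multiple (sval (cu_repr x)) n)
    (sval (cu_repr (om_muln n x))).
Proof.
elim: n => [|n IH]; first exact: cuntz_le0.
apply: cuntz_le_trans (cu_repr_class _).1; apply: cuntz_le_dsum.
  by apply: (cuntz_le_refl hunit); exact: (svalP (cu_repr x)).
exact: cuntz_leZl.
Qed.

Lemma finite_multiple_cstar (c : st_alg AK) n : c^† = c ->
  (finite_multiple c n)^† = finite_multiple c n.
Proof.
move=> cc; elim: n => [|n IH]; first exact: cstar0.
by rewrite [finite_multiple c n.+1]/finite_multiple /= cstar_dsum cc cstarZ_real IH.
Qed.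

(** The error for n + 1 is 0 ⊕ 1/4 of the error for n; the weaker rate 1/2 is enough. *)
Lemma finite_multiple_cvg (c T : st_alg AK) n :
  T = dsum c (((2^-1 ^+ 2)%:C)%C *: T) ->
  nrm (T - finite_multiple c n) <= nrm T * 2^-1 ^+ n.
Proof.
move=> TE; elim: n => [|n IH]; first by rewrite subr0 expr0 mulr1.
rewrite {1}TE -dsumB subrr -scalerBr (le_trans (nrm_dsum _ _))// nrm0 add0r.
rewrite nrmZ_real ?exprn_ge0 ?invr_ge0//.
rewrite [_ ^+ n.+1]exprS mulrCA expr2 -mulrA ler_wpM2l ?invr_ge0//.
by have := nrm_ge0 (T - finite_multiple c n); rewrite -/(finite_multiple c n); lra.
Qed.

(** An instance of the compactness of the class of a projection: p already lies below a finite stage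
    of T. *)
Lemma projection_le_finite_multiple (p c T : st_alg AK) :
  p^† = p -> p ** p = p -> c^† = c ->
  T = dsum c (((2^-1 ^+ 2)%:C)%C *: T) -> cuntz_le p T ->
  exists n, cuntz_le p (finite_multiple c n).
Proof.
move=> ps pp cs TE /cuntz_leP /(_ 2^-1)[|v hv]; first by rewrite invr_gt0.
have [|||N hN] := @geometric_lt R (nrm v ^+ 2 * nrm T) 2^-1 2^-1; rewrite ?invr_gt0//.
- by rewrite mulr_ge0 ?sqr_ge0 ?nrm_ge0.
- by lra.
exists N; set D := finite_multiple c N.
have [||||w wE] := @projection_perturb R (st_alg AK) p (v ** D ** v^†) => //.
- by rewrite !cstarM cstarK finite_multiple_cstar// cmulA.
(* One half is the distance from p to v T v†, the other half bounds the truncation error; together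
   they stay below 1. *)
- rewrite (le_lt_trans (nrm_triangle (v ** T ** v^†) _ _))// -cmulBl -cmulBr.
  have h1 := nrm_sandwich v (T - D); have h2 := hN N (leqnn N).
  have h3 := ler_wpM2l (sqr_ge0 (nrm v)) (finite_multiple_cvg N TE).
  by rewrite mulrA in h3; lra.
apply/cuntz_leP => eps eps0; exists (w ** v).
by rewrite cstarM -wE !cmulA subrr nrm0.
Qed.

Lemma projection_le_multiple (p : pos_elt AK) x : sval p ** sval p = sval p ->
  Full (Cu AK) x -> exists n, cu_le (cu_class p) (om_muln n x).
Proof.
move=> pp [s [_ sx] smax].
have [T0 T0pos TE] := infinite_multiple (svalP (cu_repr x)).
pose T : pos_elt AK := exist _ T0 T0pos.
(* [T] bounds all multiples of x, hence also their supremum, the largest element. *)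
have pT : cu_le (cu_class p) (cu_class T).
  apply: cu_le_trans (smax _) (sx _ _) => n.
  exact: cu_muln_le_infinite_multiple.
have ps := positive_cstar (svalP p).
have xs := positive_cstar (svalP (cu_repr x)).
have pT0 : cuntz_le (sval p) T0 := (cu_leP p T).1 pT.
have [n pn] := projection_le_finite_multiple ps pp xs TE pT0.
exists n; rewrite -(cu_reprK (om_muln n x)); apply/cu_leP.
exact: cuntz_le_trans pn (finite_multiple_le x n).
Qed.

(** * Functionals and the radius of comparison *)

Lemma functional_muln (l : Cu AK -> \bar R) x n : functional l ->
  l (om_muln n x) = (n%:R%:E * l x)%E.
Proof.
move=> [l0 lz lD _ _]; elim: n => [|n IH]; first by rewrite lz mul0e.
rewrite /= lD IH -nat1r EFinD ge0_muleDl ?lee_fin ?mul1e//.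
Qed.

(** For s < r/(n+1) the ranks satisfy s ŵ <= s n x̂ <= r x̂, so s-comparison relative to w
    applies. *)
Lemma r_comparison_multiple (w x : Cu AK) n (r : R) : 0 < r ->
  cu_le w (om_muln n x) -> rc R w = 0%E -> r_comparison x r.
Proof.
move=> r0 wx rcw a b hab.
(* Dividing by n + 1 rather than n covers n = 0. *)
have rn0 : 0 < r / n.+1%:R by rewrite divr_gt0.
have [s [s0 sw] sr] : exists2 s : R, 0 < s /\ r_comparison w s & s < r / n.+1%:R.
  have : (rc R w < (r / n.+1%:R)%:E)%E by rewrite rcw lte_fin.
  by move=> /ereal_inf_lt[_ [s hs <-]]; rewrite lte_fin; exists s.
apply: sw => l lf; apply: le_trans (hab l lf); have [l0 _ _ lmono _] := lf.
rewrite /om_rank leeD2l//.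
apply: (@le_trans _ _ ((r / n.+1%:R)%:E * (n%:R%:E * l x))%E).
  rewrite -functional_muln// lee_pmul ?lee_fin ?(ltW s0) ?(ltW sr)//.
  exact: lmono.
rewrite muleA -EFinM lee_wpmul2r// lee_fin -mulrA ler_piMr ?(ltW r0)//.
by rewrite mulrC ler_pdivrMr// mul1r ler_nat.
Qed.

Lemma rc_eq0 (x : Cu AK) : (forall r : R, 0 < r -> r_comparison x r) ->
  rc R x = 0%E.
Proof.
move=> h; apply/eqP; rewrite eq_le; apply/andP; split.
  apply/lee_addgt0Pr => r r0; rewrite add0e; apply: ereal_inf_lbound.
  by exists r => //; split=> //; exact: h.
by apply: le_ereal_inf_tmp => _ [r [r0 _] <-]; rewrite lee_fin ltW.
Qed.

Lemma largest_full x : (forall y, cu_le y x) -> Full (Cu AK) x.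
Proof.
move=> xmax; exists x => //; split=> [n|t /(_ 1%N)]; first exact: xmax.
apply: cu_le_trans; exact: cu_le_addr.
Qed.

End CuntzSemigroupOrder.

Theorem lemma5p10 (R : realType) (A : cstarAlgType R) (e : A)
    (AK : stabilization A) (xi : st_hilb AK)
    (hunit : is_unit_of e) (hxi : `|xi| = 1)
    (hsimple : simple_cstar A) (hfin : stably_finite e)
    (hrc : rc R (cu_unit hunit hxi) = 0%E) :
  [set rc R x | x in Full (Cu AK)] = [set 0%E].
Proof.
have ppos := unit_tens_positive hunit hxi.
have pc := rank_one_proj_compact hxi.
have rc0 x : Full (Cu AK) x -> rc R x = 0%E.
  move=> xfull; apply: rc_eq0 => r r0.
  have [|n wx] := @projection_le_multiple _ _ _ _ hunit
      (exist _ _ (unit_tens_positive (AK := AK) hunit hxi)) _ _ xfull.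
    by rewrite /= st_tensM// (hunit e).1 rank_one_proj_idem.
  exact: r_comparison_multiple r0 wx hrc.
(* For the range to be {0} and not empty, a full element has to be exhibited. *)
have [T Tpos TE] := infinite_multiple ppos.
have Tfull : Full (Cu AK) (cu_class (exist _ T Tpos)).
  apply: (largest_full hunit) => y; rewrite -(cu_reprK y); apply/(cu_leP hunit).
  by apply: (cuntz_le_infinite hunit hxi TE); exact: (svalP (cu_repr y)).
apply/seteqP; split=> [_ [x xfull <-]|_ ->]; first exact: rc0.
by exists (cu_class (exist _ T Tpos)) => //; exact: rc0.
Qed.
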